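(* Let $G:\mathbb{R}^n\to\mathbb{R}^n$ be Lipschitz continuous with constant $c<1$ (with $c\ge 0$), i.e. $\|G(\mathbf{u})-G(\mathbf{v})\|\le c\|\mathbf{u}-\mathbf{v}\|$ for all $\mathbf{u},\mathbf{v}\in\mathbb{R}^n$, and differentiable at its fixed point $\mathbf{u}^*$. Let $m\ge 1$ be an integer, $\lambda\in(0,1]$, $\mathbf{u}_0\in\mathbb{R}^n$, and let $\{\mathbf{u}_k\}$ be the (infinite) sequence generated by the algorithm GlobAA($m$). Suppose that the parameters $\{\gamma_k\}_{k\ge 0}$ satisfy: (i) $\gamma_k\in(0,1)$ for all $k\ge 0$; (ii) $\{\gamma_k\}$ is non-decreasing and $\gamma_k\to 1$ as $k\to\infty$; (iii) $\sum_{k=0}^\infty(1-\gamma_k)=\infty$. Suppose also that the coefficients $\{\alpha_j^k\}_{j=0}^{m_k}$ satisfy, for all $k\ge 1$: (a) $\big\|\sum_{j=0}^{m_k}\alpha_j^kF_{k-m_k+j}\big\|\le\|F_k\|$; (b) $\sum_{j=0}^{m_k}\alpha_j^k=1$; (c) $\sum_{j=0}^{m_k}|\alpha_j^k|\le M_\alpha$ for some constant $M_\alpha\ge 1$ independent of $k$. Then $$\limsup_{k\to\infty}\left(\frac{\|F(\mathbf{u}_k)\|}{\|F(\mathbf{u}_0)\|}\right)^{1/k}\le c,\qquad \limsup_{k\to\infty}\left(\frac{\|\mathbf{u}_k-\mathbf{u}^*\|}{\|\mathbf{u}_0-\mathbf{u}^*\|}\right)^{1/k}\le c.$$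
   Context: $\|\cdot\|$ is the Euclidean norm on $\mathbb{R}^n$. For $G:\mathbb{R}^n\to\mathbb{R}^n$ the residual mapping is $F(\mathbf{u}):=G(\mathbf{u})-\mathbf{u}$. Algorithm GlobAA($m$). Inputs: $\mathbf{u}_0\in\mathbb{R}^n$, a positive integer $m$, $\lambda\in(0,1]$, and a rule for choosing $\gamma_k\in(0,1)$. Initialize $k=0$, $\kappa=0$. While $\|F(\mathbf{u}_k)\|>0$, do the following. (1) Set $m_k=\min\{m,k-\kappa\}$, $G_k=G(\mathbf{u}_k)$, $F_k=G_k-\mathbf{u}_k$, and choose $\gamma_k$. (2) Let $(\alpha_0^k,\dots,\alpha_{m_k}^k)$ be a solution of $\min\big\|\sum_{j=0}^{m_k}\alpha_jF_{k-m_k+j}\big\|$ subject to $\sum_{j=0}^{m_k}\alpha_j=1$, and set $\mathbf{u}_{\rm AA}^{k+1}=\sum_{j=0}^{m_k}\alpha_j^kG_{k-m_k+j}$. (3) If $\|F(\mathbf{u}_{\rm AA}^{k+1})\|\le\gamma_k\max_{0\le j\le m_k}\|F_{k-m_k+j}\|$ (acceptance condition), set $\mathbf{u}_{k+1}=\mathbf{u}_{\rm AA}^{k+1}$ (Anderson step, $\kappa$ unchanged); otherwise set $\mathbf{u}_{k+1}=(1-\lambda)\mathbf{u}_k+\lambda G_k$ and reset $\kappa=k+1$ (Krasnosel'skii–Mann step). (4) Replace $k$ by $k+1$. Standing assumption: the algorithm never stops, i.e. $F(\mathbf{u}_k)\ne 0$ for all $k\ge 0$, so that an infinite sequence is generated.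 *)

(* Defs.v *)
From HB Require Import structures.
From mathcomp Require Import all_boot all_order all_algebra.
From mathcomp Require Import all_classical all_reals all_analysis.
Set Implicit Arguments.
Unset Strict Implicit.
Unset Printing Implicit Defensive.
Import Order.TTheory GRing.Theory Num.Theory.
Import numFieldNormedType.Exports.
Local Open Scope ring_scope.

(* The library norm `|u| on 'cV[R]_n is the max norm, so the Euclidean norm has
   to be introduced separately.  The topology, and hence [differentiable], is
   the same for both. *)
Definition enorm {R : realType} {n : nat} (v : 'cV[R]_n) : R :=
  Num.sqrt (\sum_(i < n) v i 0 ^+ 2).

Definition residual {R : realType} {n : nat} (G : 'cV[R]_n -> 'cV[R]_n)
    (u : 'cV[R]_n) : 'cV[R]_n :=
  G u - u.

Section GlobAA.
Context {R : realType} {n : nat}.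
Variables (G : 'cV[R]_n -> 'cV[R]_n) (m : nat) (lambda : R).
Variables (gamma : nat -> R) (u : nat -> 'cV[R]_n).

Local Notation F := (residual G).

(* [kappa k] is the value of the counter kappa at the start of iteration k. *)
Definition depth (kappa : nat -> nat) (k : nat) : nat :=
  minn m (k - kappa k).

(* A coefficient vector (a_0, ..., a_mk) is a function on nat of which only the
   values at 0, ..., mk are ever used.  Below mk <= k always holds, so the
   truncated subtraction k - mk is harmless. *)
Definition residual_comb (k mk : nat) (a : nat -> R) : 'cV[R]_n :=
  \sum_(j < mk.+1) a j *: F (u (k - mk + j)).

Definition ls_solution (k mk : nat) (a : nat -> R) : Prop :=
  \sum_(j < mk.+1) a j = 1 /\
  forall b : nat -> R, \sum_(j < mk.+1) b j = 1 ->
    enorm (residual_comb k mk a) <= enorm (residual_comb k mk b).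

Definition anderson_candidate (k mk : nat) (a : nat -> R) : 'cV[R]_n :=
  \sum_(j < mk.+1) a j *: G (u (k - mk + j)).

Definition acceptance (k mk : nat) (a : nat -> R) : bool :=
  enorm (F (anderson_candidate k mk a)) <=
  gamma k * \big[Num.max/0]_(j < mk.+1) enorm (F (u (k - mk + j))).

(* [u] is an infinite run of GlobAA(m) started at [u0], with acceptance
   parameters [gamma], counters [kappa] and coefficients
   alpha k j = alpha_j^k.  Minimizers need not be unique: any of them may be
   selected. *)
Definition globAA_run (u0 : 'cV[R]_n) (kappa : nat -> nat)
    (alpha : nat -> nat -> R) : Prop :=
  [/\ u 0%N = u0,
      kappa 0%N = 0%N,
      forall k, F (u k) != 0,
      forall k, ls_solution k (depth kappa k) (alpha k) &
      forall k,
        if acceptance k (depth kappa k) (alpha k) then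
          u k.+1 = anderson_candidate k (depth kappa k) (alpha k) /\
          kappa k.+1 = kappa k
        else
          u k.+1 = (1 - lambda) *: u k + lambda *: G (u k) /\
          kappa k.+1 = k.+1].

End GlobAA.

(* Main.v *)
Require Import Defs.
From HB Require Import structures.
From mathcomp Require Import all_boot all_order all_algebra.
From mathcomp Require Import all_classical all_reals all_analysis.
From mathcomp Require Import ring lra zify.
Set Implicit Arguments.
Unset Strict Implicit.
Unset Printing Implicit Defensive.
Import Order.TTheory GRing.Theory Num.Theory.
Import numFieldNormedType.Exports.
Local Open Scope classical_set_scope.
Local Open Scope ring_scope.

(** Write r_k for the residual norm ||F(u_k)||.  Up to the factor 1 - c it
    controls the error ||u_k - u*|| ([error_le_residual]), so both rates follow
    from the claim that, for every q in (c, 1), r_k <= C q^k with some constant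
    C: taking k-th roots kills C and then q may decrease to c
    ([root_limsup_le]).

    The residuals first have to become small.  A Krasnosel'skii-Mann step
    multiplies the residual by at most 1 - lambda (1 - c)
    ([residual_relaxation]), and an accepted Anderson step gives gamma_k times
    the maximum over the last m + 1 residuals.  As gamma_k -> 1, the second
    bound eventually covers both kinds of steps ([run_residual_le]).  Since
    gamma is non-decreasing, m + 1 consecutive steps shrink the window maximum
    by the factor gamma_k of the last of them, and the divergence of the sum of
    the 1 - gamma_k forces r_k -> 0 ([window_decay]).

    Near u* the map G is affine up to a small relative error, hence almost
    commutes with affine combinations with bounded coefficients
    ([affine_comb_remainder]).  Let ubar be the combination of the iterates u_j
    with the coefficients alpha_j.  The Anderson candidate differs from ubar by
    the combination of the residuals, whose norm is at most r_k, so the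
    contraction property bounds ||F(u_AA)|| by
    ||G(u_AA) - G(ubar)|| + ||G(ubar) - u_AA|| <= c r_k + e W,
    where W is the window maximum and e is arbitrarily small
    ([residual_anderson_le]).  Once c + e <= gamma_k this is below the
    acceptance threshold: from some index on every step is an Anderson step
    ([run_anderson_residual_le]), with r_{k+1} <= c r_k + e W.  For
    e = (q - c) q^m this recursion is compatible with the decay q^k, because
    W costs at most a factor q^-m ([window_geometric]). *)

(** * Recursions over a sliding window *)

(** A recursion over the last m + 1 terms preserves any majorant C w that it
    maps to itself; a large enough C takes care of the first K + 1 terms.  Both
    decay results below are instances, with different comparison sequences w. *)
Lemma window_comparison (R : realFieldType) (r w : nat -> R) (m K : nat) :
  (forall k, 0 <= r k) -> (forall k, 0 < w k) ->
  (forall (C : R) k, 0 <= C -> (K <= k)%N ->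
    (forall i, (k - m <= i <= k)%N -> r i <= C * w i) ->
    r k.+1 <= C * w k.+1) ->
  exists2 C : R, 0 <= C & forall k, r k <= C * w k.
Proof.
move=> r0 w0 step.
have q0 i : 0 <= r i / w i by rewrite divr_ge0// ltW.
exists (\sum_(i < K.+1) r i / w i); first exact: sumr_ge0.
elim/ltn_ind => k IH; have [kK|Kk] := ltnP k K.+1.
  rewrite -ler_pdivrMr// (bigD1 (Ordinal kK))//= lerDl.
  exact: sumr_ge0.
case: k Kk IH => // k Kk IH; apply: step => //; first exact: sumr_ge0.
by move=> i /andP[_ ik]; apply: IH.
Qed.

(** The comparison sequence is w_k = 1 / (1 + S_(k+m) / (m + 1)), where S_k is
    the sum of 1 - g_i over i < k.  It tends to 0 by divergence.  It satisfies
    g_k w_(k-m) <= w_(k+1), because the argument of S increases by m + 1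
    between the two, from k to k + m + 1, and by monotonicity of g each of the
    summands 1 - g_i involved is at most 1 - g_k. *)
Lemma window_decay (R : realFieldType) (r g : nat -> R) (m K : nat) :
  (forall k, 0 <= r k) -> (forall k, 0 < g k < 1) ->
  {homo g : i j / (i <= j)%N >-> i <= j} ->
  (forall A : R, exists k, A <= \sum_(i < k) (1 - g i)) ->
  (forall (B : R) k, (K <= k)%N ->
    (forall i, (k - m <= i <= k)%N -> r i <= B) -> r k.+1 <= g k * B) ->
  forall e : R, 0 < e -> exists k0, forall k, (k0 <= k)%N -> r k <= e.
Proof.
move=> r0 g01 gnd gdiv step.
pose S k := \sum_(i < k) (1 - g i).
have SS k : S k.+1 = S k + (1 - g k) by rewrite /S big_ord_recr.
have S0 k : 0 <= S k by apply: sumr_ge0 => i _; have := g01 i; lra.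
have Snd : {homo S : i j / (i <= j)%N >-> i <= j}.
  apply: homo_leq => // [y x z|k]; first exact: le_trans.
  by rewrite SS; have := g01 k; lra.
have Sshift k j : S (k + j)%N <= S k + j%:R * (1 - g k).
  elim: j => [|j IH]; first by rewrite addn0 mul0r addr0.
  rewrite addnS SS -natr1; have := gnd k (k + j)%N (leq_addr _ _).
  lra.
pose N : R := m.+1%:R.
have N0 : 0 < N by rewrite ltr0n.
have NV0 : 0 <= N^-1 by rewrite invr_ge0 ler0n.
pose d k := 1 + S (k + m)%N / N.
have d1 k : 1 <= d k by rewrite lerDl divr_ge0// ltW.
have d0 k : 0 < d k by rewrite (lt_le_trans _ (d1 k)).
have [] := @window_comparison R r (fun k => (d k)^-1) m (maxn K m) r0.
- by move=> k; rewrite invr_gt0.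
- move=> C k C0; rewrite geq_max => /andP[Kk mk] rC.
  pose D := d (k - m)%N.
  have DE : D = 1 + S k / N by rewrite /D /d subnK.
  have D0 : 0 < D by exact: d0.
  have rD : r k.+1 <= g k * (C / D).
    apply: step => // i ik; apply: (le_trans (rC i ik)).
    rewrite ler_wpM2l// lef_pV2 ?posrE// /D /d lerD2l ler_wpM2r//.
    by apply: Snd; rewrite leq_add2r; case/andP: ik.
  apply: (le_trans rD); rewrite mulrCA ler_wpM2l// ler_pdivrMr// ler_pdivlMl//.
  have dD : d k.+1 <= D + (1 - g k).
    rewrite DE /d -addrA lerD2l addSnnS -ler_pdivlMr ?invr_gt0// invrK mulrDl.
    rewrite divfK ?gt_eqF// mulrC; apply: le_trans (Sshift k m.+1) _.
    by rewrite mulrC.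
  have D1 : 1 <= D by exact: d1.
  have /andP[gk0 gk1] := g01 k.
  (* g (D + 1 - g) <= D amounts to (1 - g) (D - g) >= 0 with D >= 1 > g *)
  have : g k * d k.+1 <= g k * (D + (1 - g k)) by rewrite ler_wpM2l// ltW.
  nra.
move=> C C0 rC e e0.
have [k0 hk0] := gdiv (N * (C / e)).
exists k0 => k k0k; apply: (le_trans (rC k)).
rewrite ler_pdivrMr// mulrC -ler_pdivrMr// /d.
have : S k0 / N <= S (k + m)%N / N.
  by rewrite ler_wpM2r//; apply: Snd; lia.
have : C / e <= S k0 / N by rewrite ler_pdivlMr// mulrC.
move=> CS SS'; apply: (le_trans CS); apply: (le_trans SS').
by rewrite lerDr.
Qed.

(** A term of the window ending at k is at most C q^(k-m), which is where the
    condition c + e q^-m <= q comes from. *)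
Lemma window_geometric (R : realFieldType) (r : nat -> R) (c q e : R)
    (m K : nat) :
  0 <= c -> 0 < q <= 1 -> 0 <= e -> c + e * q ^- m <= q ->
  (forall k, 0 <= r k) ->
  (forall (B : R) k, (K <= k)%N ->
    (forall i, (k - m <= i <= k)%N -> r i <= B) ->
    r k.+1 <= c * r k + e * B) ->
  exists2 C : R, 0 <= C & forall k, r k <= C * q ^+ k.
Proof.
move=> c0 /andP[q0 q1] e0 ceq r0 step.
apply: (@window_comparison R r (fun k => q ^+ k) m (maxn K m)) => //.
  by move=> k; rewrite exprn_gt0.
move=> C k C0; rewrite geq_max => /andP[Kk mk] rC.
have rB : r k.+1 <= c * r k + e * (C * q ^+ (k - m)).
  apply: step => // i ik; apply: (le_trans (rC i ik)).
  rewrite ler_wpM2l// ler_wiXn2l// ?(ltW q0)//; by case/andP: ik.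
have rk : r k <= C * q ^+ k by apply: rC; rewrite leq_subr leqnn.
have qkm : q ^+ (k - m) = q ^+ k * q ^- m.
  by rewrite -{2}(subnK mk) exprD mulfK// expf_neq0// gt_eqF.
apply: (le_trans rB); rewrite qkm exprS.
have h : C * q ^+ k * (c + e * q ^- m) <= C * q ^+ k * q.
  by rewrite ler_wpM2l// mulr_ge0// exprn_ge0// ltW.
have : c * r k <= c * (C * q ^+ k) by rewrite ler_wpM2l.
lra.
Qed.

(** For c < q < p, the sequence C q^k / d is eventually below p^k, so the k-th
    roots are eventually below p.  Values of q close to c suffice, whence the
    restriction q < 1. *)
Lemma root_limsup_le (R : realType) (r : nat -> R) (c d : R) :
  0 < d -> 0 <= c < 1 -> (forall k, 0 <= r k) ->
  (forall q, c < q < 1 -> exists C : R, forall k, r k <= C * q ^+ k) ->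
  (limn_esup (fun k => ((r k / d) `^ (k%:R^-1))%:E) <= c%:E)%E.
Proof.
move=> d0 /andP[c0 c1] r0 hq; apply/lee_addgt0Pr => /= e e0.
(* p is capped below 1 so that q, halfway between c and p, is an allowed rate *)
pose p : R := Num.min (c + e) ((c + 1) / 2).
have cp : c < p by rewrite lt_min; lra.
have p1 : p < 1 by rewrite gt_min; apply/orP; right; lra.
have pe : p <= c + e by rewrite ge_min lexx.
pose q := (c + p) / 2.
have q0 : 0 < q by rewrite /q; lra.
have qp : q < p by rewrite /q; lra.
have [|C rC] := hq q; first by rewrite /q; lra.
have p0 : 0 < p by lra.
have qp1 : `|q / p| < 1.
  have qp1 : q / p < 1 by rewrite ltr_pdivrMr// mul1r.
  by rewrite gtr0_norm; [exact: qp1|exact: divr_gt0].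
have : \forall k \near \oo, `|C / d * (q / p) ^+ k| <= 1.
  have /cvgrPdist_le : (C / d * (q / p) ^+ k) @[k --> \oo] --> (0 : R).
    exact: (@cvg_geometric R).
  by move=> /(_ 1 ltr01); apply: filterS => k; rewrite sub0r normrN.
move=> [k0 _ hk0].
pose V := [set k | (maxn k0 1 <= k)%N].
apply: ge_ereal_inf.
exists (ereal_sup [set ((r k / d) `^ (k%:R^-1))%:E | k in V]).
  by exists V => //; exists (maxn k0 1).
apply: ge_ereal_sup => _ [k + <-]; rewrite /V /= geq_max => /andP[k0k k1].
rewrite -EFinD lee_fin; apply: le_trans pe.
have kp : p = (p ^+ k) `^ (k%:R^-1).
  rewrite -powR_mulrn ?(ltW p0)// -powRrM mulfV ?powRr1 ?(ltW p0)//.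
  by rewrite pnatr_eq0; lia.
have p0' := ltW p0; have d0' := ltW d0.
rewrite [leRHS]kp ge0_ler_powR ?invr_ge0 ?nnegrE ?exprn_ge0 ?divr_ge0//.
have := le_trans (ler_norm _) (hk0 k k0k).
rewrite expr_div_n mulrA ler_pdivrMr ?exprn_gt0// mul1r; apply: le_trans.
by rewrite mulrAC ler_wpM2r ?invr_ge0.
Qed.

(** * The Euclidean norm *)

Section EuclideanNorm.
Context {R : realType} {n : nat}.
Implicit Types u v w : 'cV[R]_n.

Lemma enorm_ge0 v : 0 <= enorm v.
Proof. exact: sqrtr_ge0. Qed.

Lemma enorm_sqr v : enorm v ^+ 2 = \sum_(i < n) v i 0 ^+ 2.
Proof. by rewrite sqr_sqrtr// sumr_ge0// => i _; rewrite sqr_ge0. Qed.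

Lemma enorm0 : enorm (0 : 'cV[R]_n) = 0.
Proof.
by rewrite /enorm big1 ?sqrtr0// => i _; rewrite mxE expr0n.
Qed.

Lemma enormZ a v : enorm (a *: v) = `|a| * enorm v.
Proof.
rewrite /enorm -sqrtr_sqr -sqrtrM ?sqr_ge0//; congr Num.sqrt.
by rewrite mulr_sumr; apply: eq_bigr => i _; rewrite mxE exprMn.
Qed.

Lemma enormN v : enorm (- v) = enorm v.
Proof. by rewrite -scaleN1r enormZ normrN1 mul1r. Qed.

Lemma enorm_eq0 v : (enorm v == 0) = (v == 0).
Proof.
apply/eqP/eqP => [v0|->]; last exact: enorm0.
have := enorm_sqr v; rewrite v0 expr0n/= => /esym/eqP.
rewrite psumr_eq0 => [/allP h|i _]; last exact: sqr_ge0.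
apply/matrixP => i j; rewrite ord1 mxE.
by have := h i; rewrite mem_index_enum sqrf_eq0 => /(_ isT)/eqP.
Qed.

(** Cauchy-Schwarz: expand || s u - t v ||^2 >= 0 at s = ||v||, t = ||u||. *)
Lemma dot_le_enorm u v : \sum_(i < n) u i 0 * v i 0 <= enorm u * enorm v.
Proof.
set d := \sum_(i < n) _; have U0 := enorm_ge0 u; have V0 := enorm_ge0 v.
have key (s t : R) : 0 <= s ^+ 2 * enorm u ^+ 2 - (s * t * d) *+ 2
    + t ^+ 2 * enorm v ^+ 2.
  suff -> : s ^+ 2 * enorm u ^+ 2 - (s * t * d) *+ 2 + t ^+ 2 * enorm v ^+ 2
      = \sum_(i < n) (s * u i 0 - t * v i 0) ^+ 2.
    by apply: sumr_ge0 => i _; rewrite sqr_ge0.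
  rewrite !enorm_sqr /d !mulr_sumr -sumrMnl -sumrN -!big_split/=.
  by apply: eq_bigr => i _; ring.
have [u0|u0] := eqVneq (enorm u) 0.
  move/eqP: (u0); rewrite enorm_eq0 => /eqP uv0.
  by rewrite /d uv0 big1 ?enorm0 ?mul0r// => i _; rewrite mxE mul0r.
have [v0|v0] := eqVneq (enorm v) 0.
  move/eqP: (v0); rewrite enorm_eq0 => /eqP uv0.
  by rewrite /d uv0 big1 ?enorm0 ?mulr0// => i _; rewrite mxE mulr0.
have UV : 0 < enorm u * enorm v by rewrite mulr_gt0// lt0r ?u0 ?v0.
rewrite -(ler_pM2l UV) -subr_ge0 -(pmulrn_lge0 _ (ltn0Sn 1)).
suff <- : enorm v ^+ 2 * enorm u ^+ 2 - (enorm v * enorm u * d) *+ 2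
    + enorm u ^+ 2 * enorm v ^+ 2
  = (enorm u * enorm v * (enorm u * enorm v) - enorm u * enorm v * d) *+ 2.
  exact: key.
by ring.
Qed.

Lemma enormD u v : enorm (u + v) <= enorm u + enorm v.
Proof.
rewrite -(@ler_pXn2r _ 2) ?nnegrE ?addr_ge0 ?enorm_ge0//.
have -> : enorm (u + v) ^+ 2
    = enorm u ^+ 2 + (\sum_(i < n) u i 0 * v i 0) *+ 2 + enorm v ^+ 2.
  rewrite !enorm_sqr -sumrMnl -!big_split/=.
  by apply: eq_bigr => i _; rewrite mxE; ring.
by rewrite sqrrD lerD2r lerD2l lerMn2r dot_le_enorm orbT.
Qed.

Lemma enormB u v : enorm (u - v) <= enorm u + enorm v.
Proof. by rewrite -[enorm v]enormN enormD. Qed.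

Lemma enorm_sum_le k (a : 'I_k -> R) (x : 'I_k -> 'cV[R]_n) (B : R) :
  (forall j, enorm (x j) <= B) ->
  enorm (\sum_j a j *: x j) <= (\sum_j `|a j|) * B.
Proof.
move=> xB; rewrite mulr_suml.
elim/big_ind2 : _ => [|v s w t hv hw|j _]; first by rewrite enorm0.
  by rewrite (le_trans (enormD _ _))// lerD.
by rewrite enormZ ler_wpM2l.
Qed.

Lemma norm_le_enorm v : `|v| <= enorm v.
Proof.
rewrite [leLHS]mx_normrE; apply: bigmax_le; first exact: enorm_ge0.
move=> [i j] _ /=; rewrite ord1 -sqrtr_sqr ler_wsqrtr// (bigD1 i)//=.
by rewrite lerDl sumr_ge0// => k _; rewrite sqr_ge0.
Qed.

Lemma enorm_le_norm v : enorm v <= Num.sqrt n%:R * `|v|.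
Proof.
rewrite -[`|v|]ger0_norm// -sqrtr_sqr -sqrtrM ?ler0n// ler_wsqrtr//.
have -> : n%:R * `|v| ^+ 2 = \sum_(i < n) `|v| ^+ 2.
  by rewrite sumr_const card_ord mulr_natl.
apply: ler_sum => i _.
rewrite -[leLHS]real_normK ?num_real// ler_pXn2r ?nnegrE//.
by rewrite [leRHS]mx_normrE (le_bigmax _ (fun ij => `|v ij.1 ij.2|) (i, 0)).
Qed.

End EuclideanNorm.

(** * Differentiability and affine combinations *)

(** The two norms bound each other, at the price of the factor s below, so the
    defining estimate of the derivative transfers to the Euclidean norm. *)
Lemma differentiable_enorm (R : realType) (n : nat) (G : 'cV[R]_n -> 'cV[R]_n)
    (x : 'cV[R]_n) :
  differentiable G x ->
  forall e : R, 0 < e -> exists2 d : R, 0 < d & forall y, enorm (y - x) <= d ->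
    enorm (G y - G x - 'd G x (y - x)) <= e * enorm (y - x).
Proof.
move=> dG e e0.
(* the summand 1 keeps s positive in dimension 0 *)
pose s : R := Num.sqrt n%:R + 1.
have s0 : 0 < s by rewrite ltr_wpDl ?sqrtr_ge0.
have /eqaddoP/(_ _ (divr_gt0 e0 s0)) := diff_locally dG.
move=> /nbhs_ballP[d /= d0 dball].
exists (d / 2); first by rewrite divr_gt0.
move=> y yd.
have := dball (y - x); rewrite -ball_normE /= sub0r normrN.
have ydd : `|y - x| < d.
  by apply: le_lt_trans (norm_le_enorm _) _; lra.
move=> /(_ ydd); rewrite /cst /= !fctE /= subrK.
rewrite opprD addrA => yx.
apply: le_trans (enorm_le_norm _) _.
apply: (@le_trans _ _ (s * `|G y - G x - 'd G x (y - x)|)).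
  by rewrite ler_wpM2r// lerDl.
rewrite -ler_pdivlMl// mulrA [s^-1 * e]mulrC.
apply: (le_trans yx); rewrite ler_wpM2l ?norm_le_enorm//.
by rewrite divr_ge0// ltW.
Qed.

(** The affine part of G at x commutes with affine combinations, so only the
    remainders of the points and of their combination contribute.  The latter
    lies within M B of x, hence the radius d / M. *)
Lemma affine_comb_remainder (R : realType) (n : nat) (G : 'cV[R]_n -> 'cV[R]_n)
    (x : 'cV[R]_n) (M : R) :
  differentiable G x -> 1 <= M ->
  forall e : R, 0 < e -> exists2 d : R, 0 < d &
    forall k (a : 'I_k -> R) (y : 'I_k -> 'cV[R]_n) (B : R),
      \sum_j a j = 1 -> \sum_j `|a j| <= M ->
      (forall j, enorm (y j - x) <= B) -> 0 <= B <= d ->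
      enorm (G (\sum_j a j *: y j) - \sum_j a j *: G (y j)) <= e * B.
Proof.
move=> dG M1 e e0; have M0 : 0 < M by lra.
have e'0 : 0 < e / (2 * M) by rewrite divr_gt0// mulr_gt0.
have [d d0 hd] := differentiable_enorm dG e'0.
exists (d / M); first by rewrite divr_gt0.
move=> k a y B a1 aM yB /andP[B0 Bd].
have MBd : M * B <= d by rewrite mulrC -ler_pdivlMr.
have Bd' : B <= d by apply: le_trans MBd; rewrite ler_peMl.
(* the remainder of the first-order expansion at x *)
pose E z := G z - G x - 'd G x (z - x).
pose ybar := \sum_j a j *: y j.
have ybarE : ybar - x = \sum_j a j *: (y j - x).
  rewrite -[X in _ - X]scale1r -a1 scaler_suml -sumrB.
  by apply: eq_bigr => j _; rewrite scalerBr.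
have -> : G ybar - \sum_j a j *: G (y j) = E ybar - \sum_j a j *: E (y j).
  have -> : \sum_j a j *: E (y j)
      = \sum_j a j *: G (y j) - G x - 'd G x (ybar - x).
    rewrite ybarE linear_sum/= -[X in _ - X - _]scale1r -a1 scaler_suml -!sumrB.
    have dZ b v : 'd G x (b *: v) = b *: 'd G x v by exact: linearZ.
    by apply: eq_bigr => j _; rewrite dZ -!scalerBr.
  rewrite /E -[X in _ = _ - X]addrA -[X in _ = X - _]addrA.
  by rewrite [X in _ = _ - X]addrC addrKA.
have ybarB : enorm (ybar - x) <= M * B.
  by rewrite ybarE (le_trans (enorm_sum_le _ yB))// ler_wpM2r.
have Ey j : enorm (E (y j)) <= e / (2 * M) * B.
  by rewrite (le_trans (hd _ (le_trans (yB j) Bd')))// ler_wpM2l// ltW.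
have Eybar : enorm (E ybar) <= e / (2 * M) * (M * B).
  by rewrite (le_trans (hd _ (le_trans ybarB MBd)))// ler_wpM2l// ltW.
apply: (le_trans (enormB _ _)).
apply: (le_trans (lerD Eybar (enorm_sum_le _ Ey))).
have : (\sum_j `|a j|) * (e / (2 * M) * B) <= M * (e / (2 * M) * B).
  by rewrite ler_wpM2r// mulr_ge0// ltW.
have -> : e / (2 * M) * (M * B) = e * B / 2 by field; lra.
have -> : M * (e / (2 * M) * B) = e * B / 2 by field; lra.
lra.
Qed.

(** * Residuals of a contraction *)

Section Contraction.
Context {R : realType} {n : nat}.
Variables (G : 'cV[R]_n -> 'cV[R]_n) (c : R).
Hypothesis hG : forall x y, enorm (G x - G y) <= c * enorm (x - y).

(** F(v) = (G(v) - G(u)) + (1 - lambda) F(u), and v - u = lambda F(u). *)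
Lemma residual_relaxation (lambda : R) u : 0 <= lambda <= 1 ->
  enorm (residual G ((1 - lambda) *: u + lambda *: G u)) <=
  (1 - lambda * (1 - c)) * enorm (residual G u).
Proof.
move=> /andP[l0 l1]; set v := _ + _.
have vu : v - u = lambda *: residual G u.
  by apply/matrixP => i j; rewrite !mxE; ring.
have -> : residual G v = G v - G u + (1 - lambda) *: residual G u.
  rewrite scalerBl scale1r -vu /residual.
  by apply/matrixP => i j; rewrite !mxE; ring.
apply: (le_trans (enormD _ _)).
have := hG v u; rewrite vu !enormZ !ger0_norm ?subr_ge0//.
lra.
Qed.

(** u - x = (G(u) - G(x)) - F(u) when x is a fixed point. *)
Lemma error_le_residual u x : G x = x ->
  (1 - c) * enorm (u - x) <= enorm (residual G u).
Proof.
move=> Gx; have := enormB (G u - G x) (residual G u).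
have -> : G u - G x - residual G u = u - x.
  by rewrite Gx /residual; apply/matrixP => i j; rewrite !mxE; ring.
by have := hG u x; lra.
Qed.

(** The local gain of an Anderson step.  With w the candidate and ybar the
    combination of the points y_j, F(w) = (G(w) - G(ybar)) + (G(ybar) - w): the
    first term is contracted because w - ybar is the combination of the
    residuals, and the second is the defect of affinity of G.  A residual bound
    B places the points within B / (1 - c) of x. *)
Lemma residual_anderson_le (x : 'cV[R]_n) (M : R) :
  0 <= c < 1 -> G x = x -> differentiable G x -> 1 <= M ->
  forall e : R, 0 < e -> exists2 d : R, 0 < d &
    forall k (a : 'I_k -> R) (y : 'I_k -> 'cV[R]_n) (B : R),
      \sum_j a j = 1 -> \sum_j `|a j| <= M ->
      (forall j, enorm (residual G (y j)) <= B) -> 0 <= B <= d ->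
      enorm (residual G (\sum_j a j *: G (y j))) <=
      c * enorm (\sum_j a j *: residual G (y j)) + e * B.
Proof.
move=> /andP[c0 c1] Gx dG M1 e e0.
have c1' : 0 < 1 - c by lra.
have [d d0 hd] := affine_comb_remainder dG M1 (mulr_gt0 e0 c1').
exists (d * (1 - c)); first by rewrite mulr_gt0.
move=> k a y B a1 aM yB /andP[B0 Bd].
set w := \sum_j a j *: G (y j); set z := \sum_j _.
pose ybar := \sum_j a j *: y j.
have wz : w - ybar = z.
  by rewrite /z /w -sumrB; apply: eq_bigr => j _; rewrite scalerBr.
have -> : residual G w = (G w - G ybar) + (G ybar - w) by rewrite addrA subrK.
apply: (le_trans (enormD _ _)); apply: lerD; first by rewrite -wz hG.
have BE : e * B = e * (1 - c) * (B / (1 - c)) by field; lra.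
rewrite BE; apply: hd => // [j|].
  by rewrite ler_pdivlMr// mulrC (le_trans (error_le_residual _ Gx)).
by rewrite divr_ge0 ?(ltW c1')// ler_pdivrMr.
Qed.

End Contraction.

(** * Runs of the algorithm *)

Lemma nneseries_unbounded (R : realType) (f : nat -> R) :
  (forall k, 0 <= f k) -> (\sum_(0 <= k <oo) (f k)%:E = +oo)%E ->
  forall A : R, exists k, A <= \sum_(i < k) f i.
Proof.
move=> f0 foo A; apply: contrapT => /forallNP fA.
suff : (\sum_(0 <= k <oo) (f k)%:E <= A%:E)%E by rewrite foo.
apply: lime_le; first by apply: is_cvg_nneseries => k _ _; rewrite lee_fin.
apply: nearW => k; rewrite sumEFin lee_fin big_mkord ltW// ltNge.
exact/negP.
Qed.

Section Run.
Context {R : realType} {n : nat}.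
Variables (G : 'cV[R]_n -> 'cV[R]_n) (m : nat) (lambda : R).
Variables (gamma : nat -> R) (u : nat -> 'cV[R]_n) (u0 : 'cV[R]_n).
Variables (kappa : nat -> nat) (alpha : nat -> nat -> R).
Hypothesis hrun : globAA_run G m lambda gamma u u0 kappa alpha.

Local Notation r k := (enorm (residual G (u k))).
Local Notation mk k := (depth m kappa k).

Lemma window_index k (j : 'I_(mk k).+1) :
  (k - m <= k - mk k + j <= k)%N.
Proof.
have := ltn_ord j; have : (mk k <= m)%N by rewrite geq_minl.
have : (mk k <= k)%N by rewrite (leq_trans (geq_minr _ _))// leq_subr.
lia.
Qed.

(** The hypothesis on gamma k makes the acceptance bound hold for relaxation
    steps too, so that both kinds of steps obey the same recursion. *)
Lemma run_residual_le c k B :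
  (forall x y, enorm (G x - G y) <= c * enorm (x - y)) ->
  0 < lambda <= 1 -> 0 <= gamma k -> 1 - lambda * (1 - c) <= gamma k ->
  (forall i, (k - m <= i <= k)%N -> r i <= B) -> r k.+1 <= gamma k * B.
Proof.
move=> hG /andP[l0 l1] g0 gk rB.
have rkB : r k <= B by apply: rB; rewrite leq_subr leqnn.
have B0 : 0 <= B by apply: le_trans rkB; exact: enorm_ge0.
have [_ _ _ _ /(_ k)] := hrun; case: ifP => [acc|_] [-> _].
  apply: (le_trans acc); rewrite ler_wpM2l//.
  by apply: bigmax_le => // j _; apply: rB; exact: window_index.
apply: (le_trans (residual_relaxation hG _ _)); first by rewrite ltW.
apply: (@le_trans _ _ (gamma k * r k)); last by rewrite ler_wpM2l.
by rewrite ler_wpM2r ?enorm_ge0.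
Qed.

(** An estimate c r_k + e W for the candidate, W being the maximum over the
    actual window, is at most (c + e) W <= gamma_k W: the candidate passes the
    acceptance test and the estimate is inherited by r_{k+1}. *)
Lemma run_anderson_residual_le c k d e B :
  0 <= c -> 0 < e -> c + e <= gamma k ->
  enorm (residual_comb G u k (mk k) (alpha k)) <= r k ->
  (forall B,
    (forall j : 'I_(mk k).+1, r (k - mk k + j)%N <= B) -> 0 <= B <= d ->
    enorm (residual G (anderson_candidate G u k (mk k) (alpha k))) <=
    c * enorm (residual_comb G u k (mk k) (alpha k)) + e * B) ->
  B <= d -> (forall i, (k - m <= i <= k)%N -> r i <= B) ->
  r k.+1 <= c * r k + e * B.
Proof.
move=> c0 e0 ceg comb hd Bd rB.
set W := \big[Num.max/0]_(j < (mk k).+1) r (k - mk k + j)%N.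
have rW (j : 'I_(mk k).+1) : r (k - mk k + j)%N <= W.
  exact: (le_bigmax _ (fun j : 'I_(mk k).+1 => r (k - mk k + j)%N)).
have W0 : 0 <= W by apply: le_trans (rW ord0); exact: enorm_ge0.
have WB : W <= B.
  apply: bigmax_le => [|j _]; last by apply: rB; exact: window_index.
  apply: (@le_trans _ _ (r k)); first exact: enorm_ge0.
  by apply: rB; rewrite leq_subr leqnn.
have rkW : r k <= W.
  have := rW ord_max; rewrite /= subnK//.
  by rewrite (leq_trans (geq_minr _ _))// leq_subr.
have cand : enorm (residual G (anderson_candidate G u k (mk k) (alpha k)))
    <= c * r k + e * W.
  apply: (le_trans (hd W rW _)); first by rewrite W0 (le_trans WB).
  by rewrite lerD2r ler_wpM2l.
have acc : acceptance G gamma u k (mk k) (alpha k).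
  apply: (le_trans cand); apply: (@le_trans _ _ ((c + e) * W)).
    by rewrite mulrDl lerD2r ler_wpM2l.
  by rewrite ler_wpM2r.
have [_ _ _ _ /(_ k)] := hrun; rewrite acc => -[-> _].
by rewrite (le_trans cand)// lerD2l ler_wpM2l// ltW.
Qed.

End Run.

Section Rate.
Context {R : realType} {n : nat}.
Variables (G : 'cV[R]_n -> 'cV[R]_n) (c : R) (ustar : 'cV[R]_n) (m : nat).
Variables (lambda : R) (u0 : 'cV[R]_n) (gamma : nat -> R).
Variables (u : nat -> 'cV[R]_n) (kappa : nat -> nat).
Variables (alpha : nat -> nat -> R) (M : R).
Hypotheses (hc : 0 <= c < 1)
    (hG : forall x y : 'cV[R]_n, enorm (G x - G y) <= c * enorm (x - y))
    (hfix : G ustar = ustar)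
    (hdiff : differentiable G ustar)
    (hlambda : 0 < lambda <= 1)
    (hrun : globAA_run G m lambda gamma u u0 kappa alpha)
    (hgamma : forall k, 0 < gamma k < 1)
    (hgamma_nd : {homo gamma : i j / (i <= j)%N >-> i <= j})
    (hgamma_cvg : gamma k @[k --> \oo] --> (1 : R))
    (hgamma_sum : (\sum_(0 <= k <oo) (1 - gamma k)%:E = +oo)%E)
    (hM : 1 <= M)
    (ha : forall k, (1 <= k)%N ->
      enorm (residual_comb G u k (depth m kappa k) (alpha k)) <=
      enorm (residual G (u k)))
    (hb : forall k, (1 <= k)%N ->
      \sum_(j < (depth m kappa k).+1) alpha k j = 1)
    (hcoef : forall k, (1 <= k)%N ->
      \sum_(j < (depth m kappa k).+1) `|alpha k j| <= M).

Local Notation r k := (enorm (residual G (u k))).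

Lemma run_residual_small (e : R) : 0 < e ->
  exists K, forall k, (K <= k)%N -> r k <= e.
Proof.
have /andP[c0 c1] := hc; have /andP[l0 l1] := hlambda.
have lc1 : 1 - lambda * (1 - c) < 1.
  by rewrite ltrBlDr ltrDl mulr_gt0// subr_gt0.
have [K _ hK] := cvgr_ge _ hgamma_cvg _ lc1.
apply: (@window_decay R (fun k => r k) gamma m K) => //.
- by move=> k; exact: enorm_ge0.
- apply: nneseries_unbounded hgamma_sum => k.
  by rewrite subr_ge0 ltW//; case/andP: (hgamma k).
- move=> B k Kk; apply: (run_residual_le hrun hG) => //; last exact: hK.
  by rewrite ltW//; case/andP: (hgamma k).
Qed.

(** The choice e = (q - c) q^m gives c + e q^-m = q, as the geometric
    comparison requires, and c + e <= q < 1, so that gamma_k eventually exceeds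
    c + e. *)
Lemma run_residual_geometric (q : R) : c < q < 1 ->
  exists2 C : R, 0 <= C & forall k, r k <= C * q ^+ k.
Proof.
have /andP[c0 c1] := hc; move=> /andP[cq q1].
have q0 : 0 < q by lra.
pose e := (q - c) * q ^+ m.
have e0 : 0 < e by rewrite mulr_gt0 ?exprn_gt0// subr_gt0.
have eqc : e <= q - c.
  by rewrite ler_piMr ?exprn_ile1 ?(ltW q0) ?(ltW q1)// subr_ge0 ltW.
have [d d0 hd] := residual_anderson_le hG hc hfix hdiff hM e0.
have [K1 hK1] := run_residual_small d0.
have ce1 : c + e < 1 by lra.
have [K2 _ hK2] := cvgr_ge _ hgamma_cvg _ ce1.
apply: (@window_geometric R (fun k => r k) c q e m
    (maxn (K1 + m) (maxn K2 1))) => //.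
- by rewrite q0 ltW.
- exact: ltW.
- by rewrite mulfK ?subrKC// expf_neq0// gt_eqF.
- by move=> k; exact: enorm_ge0.
move=> B k; rewrite !geq_max => /and3P[K1k K2k k1] rB.
(* the local estimate needs a window bound that is also at most d *)
have rD i : (k - m <= i <= k)%N -> r i <= Num.min B d.
  by move=> ik; rewrite le_min rB//= hK1//; lia.
have : r k.+1 <= c * r k + e * Num.min B d.
  apply: (run_anderson_residual_le hrun (d := d)) => //.
  - exact: hK2.
  - exact: ha.
  - move=> B' rB' B'd.
    by apply: (hd _ (fun j => alpha k j)
                    (fun j => u (k - depth m kappa k + j)));
      [exact: hb|exact: hcoef|exact: rB'|].
  - by rewrite ge_min lexx orbT.
move/le_trans; apply; rewrite lerD2l ler_wpM2l ?(ltW e0)//.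
by rewrite ge_min lexx.
Qed.

End Rate.

Theorem theorem2p10 (R : realType) (n : nat) (G : 'cV[R]_n -> 'cV[R]_n) (c : R)
    (ustar : 'cV[R]_n) (m : nat) (lambda : R) (u0 : 'cV[R]_n)
    (gamma : nat -> R) (u : nat -> 'cV[R]_n) (kappa : nat -> nat)
    (alpha : nat -> nat -> R) (M : R)
    (hc : 0 <= c < 1)
    (hG : forall x y : 'cV[R]_n, enorm (G x - G y) <= c * enorm (x - y))
    (hfix : G ustar = ustar)
    (hdiff : differentiable G ustar)
    (hm : (1 <= m)%N)
    (hlambda : 0 < lambda <= 1)
    (hrun : globAA_run G m lambda gamma u u0 kappa alpha)
    (hgamma : forall k, 0 < gamma k < 1)
    (hgamma_nd : {homo gamma : i j / (i <= j)%N >-> i <= j})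
    (hgamma_cvg : gamma k @[k --> \oo] --> (1 : R))
    (hgamma_sum : (\sum_(0 <= k <oo) (1 - gamma k)%:E = +oo)%E)
    (hM : 1 <= M)
    (ha : forall k, (1 <= k)%N ->
      enorm (residual_comb G u k (depth m kappa k) (alpha k)) <=
      enorm (residual G (u k)))
    (hb : forall k, (1 <= k)%N ->
      \sum_(j < (depth m kappa k).+1) alpha k j = 1)
    (hcoef : forall k, (1 <= k)%N ->
      \sum_(j < (depth m kappa k).+1) `|alpha k j| <= M) :
  (limn_esup (fun k : nat =>
     ((enorm (residual G (u k)) / enorm (residual G (u 0%N)))
        `^ (k%:R^-1))%:E) <= c%:E)%E /\
  (limn_esup (fun k : nat =>
     ((enorm (u k - ustar) / enorm (u 0%N - ustar))
        `^ (k%:R^-1))%:E) <= c%:E)%E.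
Proof.
have /andP[c0 c1] := hc; have [_ _ F0 _ _] := hrun.
have c1' : 0 < 1 - c by lra.
have geo := run_residual_geometric hc hG hfix hdiff hlambda hrun hgamma
  hgamma_nd hgamma_cvg hgamma_sum hM ha hb hcoef.
have err k := error_le_residual hG (u k) hfix.
split; apply: root_limsup_le => //.
- by rewrite lt0r enorm_eq0 F0 enorm_ge0.
- by move=> k; exact: enorm_ge0.
- by move=> q /geo[C _ rC]; exists C.
- rewrite lt0r enorm_eq0 enorm_ge0 andbT subr_eq0.
  by apply: contra_neq (F0 0%N) => ->; rewrite /residual hfix subrr.
- by move=> k; exact: enorm_ge0.
- move=> q /geo[C _ rC]; exists (C / (1 - c)) => k.
  rewrite mulrAC ler_pdivlMr// mulrC.
  exact: le_trans (err k) (rC k).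
Qed.
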